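(* Let $X(t,\theta,\phi)$ be a kinematic three-dimensional surface in $\mathbf{E}^7$ obtained by the equiform motion of a sphere (as defined in the context). If $X$ has constant scalar curvature $\mathbf{K}$, then $|\mathbf{K}|<2$.
   Context: Kinematic surface. Given real parameters $s'$, $\omega_1,\dots,\omega_{15}$ and $b'_1,\dots,b'_7$, put $\vec b=(b'_1,\dots,b'_7)^{T}$, $\vec a_0(t)=(1+s't,-\omega_1t,-\omega_2t,-\omega_3t,-\omega_4t,-\omega_5t,-\omega_6t)^T$, $\vec a_1(t)=(\omega_1t,1+s't,-\omega_7t,-\omega_8t,-\omega_9t,-\omega_{10}t,-\omega_{11}t)^T$, $\vec a_2(t)=(\omega_2t,\omega_7t,1+s't,-\omega_{12}t,-\omega_{13}t,-\omega_{14}t,-\omega_{15}t)^T$. The kinematic 3-surface is the first-order (in $t$) motion of the unit 2-sphere of the 3-space $[x_1x_2x_3]$ under a one-parameter equiform motion of $\mathbf{E}^7$: $$X(t,\theta,\phi)=t\,\vec b+\cos\theta\cos\phi\,\vec a_0(t)+\sin\theta\cos\phi\,\vec a_1(t)+\sin\phi\,\vec a_2(t),\quad \theta\in[0,2\pi],\ \phi\in[0,\pi].$$ Here $s'$ is the derivative at $t=0$ of the scaling factor, the $\omega_i$ are entries of the skew-symmetric derivative at $t=0$ of the rotation part, and $\vec b$ is the derivative at $t=0$ of the translation part. Standing assumptions. (1) Each slice $t=\mathrm{const}$ is a round 2-sphere, expressed by $\sum_{i=2}^{6}\omega_i\omega_{i+5}=0$, $\ \omega_1\omega_7-\sum_{i=3}^{6}\omega_i\omega_{i+9}=0$,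 $\ \omega_1\omega_2+\sum_{i=8}^{11}\omega_i\omega_{i+4}=0$, $\ \sum_{i=2}^{6}\omega_i^2=\sum_{i=7}^{11}\omega_i^2$, $\ \omega_1^2+\sum_{i=3}^{6}\omega_i^2=\omega_7^2+\sum_{i=12}^{15}\omega_i^2$. (2) There is no translation in the space containing the starting sphere: $b'_1=b'_2=b'_3=0$. Scalar curvature. Let $(g_{ij})$ be the metric induced by $X$ from $\mathbf{E}^7$ in the coordinates $(x_1,x_2,x_3)=(t,\theta,\phi)$, $(g^{ij})$ its inverse matrix and $\Gamma_{ij}^l$ its Christoffel symbols of the second kind. The scalar curvature is $$\mathbf{K}(t,\theta,\phi)=g^{ij}\big[\partial_l\Gamma_{ij}^l-\partial_j\Gamma_{il}^l+\Gamma_{ij}^l\Gamma_{lm}^m-\Gamma_{il}^m\Gamma_{jm}^l\big].$$ It is considered at the zero position $t=0$: $\mathbf{K}=\mathbf{K}(0,\theta,\phi)$, and ''constant scalar curvature'' means that this value does not depend on $\theta,\phi$.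
   Formalization: Added: s' ≠ 0, or some ω_i ≠ 0 and some b'_i ≠ 0. Without this the claim fails: s'=0, ω=0, b'=e_4 gives a cylinder with K=2, and a pure rotation (s'=0, b'=0) can give K=−2. Constancy is required only where the induced metric is invertible. *)

(* Defs.v *)
From HB Require Import structures.
From mathcomp Require Import all_boot all_order all_algebra.
From mathcomp Require Import all_classical all_reals all_analysis.

Set Implicit Arguments.
Unset Strict Implicit.
Unset Printing Implicit Defensive.

Import Order.TTheory GRing.Theory Num.Theory.
Import numFieldNormedType.Exports.

Local Open Scope ring_scope.

(** ** Riemannian geometry of a parametrized 3-surface *)

Definition dotv (R : realType) (n : nat) (u v : 'rV[R]_n) : R :=
  \sum_(k < n) u 0 k * v 0 k.

Definition partial (R : realType) (V : normedModType R) (i : 'I_3)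
  (f : 'rV[R]_3 -> V) (p : 'rV[R]_3) : V := 'D_(delta_mx 0 i) f p.

Definition induced_metric (R : realType) (n : nat)
  (X : 'rV[R]_3 -> 'rV[R]_n.+1) (p : 'rV[R]_3) : 'M[R]_3 :=
  \matrix_(i, j) dotv (partial i X p) (partial j X p).

(* Since [invmx A = A] when [A] is singular, [christoffel g l i j p] and
   [scalar_curvature g p] are meaningful only where [g p \in unitmx]. *)
Definition christoffel (R : realType) (g : 'rV[R]_3 -> 'M[R]_3)
  (l i j : 'I_3) (p : 'rV[R]_3) : R :=
  2^-1 * \sum_(m < 3) invmx (g p) l m *
    (partial i (fun q => g q j m) p
     + partial j (fun q => g q i m) p
     - partial m (fun q => g q i j) p).

Definition scalar_curvature (R : realType) (g : 'rV[R]_3 -> 'M[R]_3)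
  (p : 'rV[R]_3) : R :=
  let Gamma := christoffel g in
  \sum_(i < 3) \sum_(j < 3) invmx (g p) i j *
    (\sum_(l < 3) partial l (fun q => Gamma l i j q) p
     - \sum_(l < 3) partial j (fun q => Gamma l i l q) p
     + \sum_(l < 3) \sum_(m < 3) Gamma l i j p * Gamma m l m p
     - \sum_(l < 3) \sum_(m < 3) Gamma m i l p * Gamma l j m p).

(** ** The kinematic surface *)

(* The parameters omega_1, ..., omega_15 and b'_1, ..., b'_7 are given by
   sequences [w b : nat -> R]; only the entries with these (1-based) indices
   are ever used. *)

Definition vec7 (R : realType) (s : seq R) : 'rV[R]_7 := \row_(k < 7) s`_k.

Definition vb (R : realType) (b : nat -> R) : 'rV[R]_7 :=
  vec7 [:: b 1; b 2; b 3; b 4; b 5; b 6; b 7]%N.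

Definition va0 (R : realType) (s : R) (w : nat -> R) (t : R) : 'rV[R]_7 :=
  vec7 [:: 1 + s * t; - w 1%N * t; - w 2%N * t; - w 3%N * t;
           - w 4%N * t; - w 5%N * t; - w 6%N * t].

Definition va1 (R : realType) (s : R) (w : nat -> R) (t : R) : 'rV[R]_7 :=
  vec7 [:: w 1%N * t; 1 + s * t; - w 7%N * t; - w 8%N * t;
           - w 9%N * t; - w 10%N * t; - w 11%N * t].

Definition va2 (R : realType) (s : R) (w : nat -> R) (t : R) : 'rV[R]_7 :=
  vec7 [:: w 2%N * t; w 7%N * t; 1 + s * t; - w 12%N * t;
           - w 13%N * t; - w 14%N * t; - w 15%N * t].

Definition point3 (R : realType) (t theta phi : R) : 'rV[R]_3 :=
  \row_(k < 3) [:: t; theta; phi]`_k.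

Definition kinematic_surface (R : realType) (s : R) (w b : nat -> R)
  (p : 'rV[R]_3) : 'rV[R]_7 :=
  let t := p 0 0 in let theta := p 0 1 in let phi := p 0 2%:R in
  t *: vb b + (cos theta * cos phi) *: va0 s w t
  + (sin theta * cos phi) *: va1 s w t + sin phi *: va2 s w t.

Definition round_slices (R : realType) (w : nat -> R) : Prop :=
  [/\ \sum_(2 <= i < 7) w i * w (i + 5)%N = 0,
      w 1%N * w 7%N - \sum_(3 <= i < 7) w i * w (i + 9)%N = 0,
      w 1%N * w 2%N + \sum_(8 <= i < 12) w i * w (i + 4)%N = 0,
      \sum_(2 <= i < 7) w i ^+ 2 = \sum_(7 <= i < 12) w i ^+ 2 &
      w 1%N ^+ 2 + \sum_(3 <= i < 7) w i ^+ 2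
        = w 7%N ^+ 2 + \sum_(12 <= i < 16) w i ^+ 2].

Definition no_inner_translation (R : realType) (b : nat -> R) : Prop :=
  [/\ b 1%N = 0, b 2%N = 0 & b 3%N = 0].

(* The two degenerate Euclidean motions (s' = 0) are excluded: no rotation, or
   no translation.  The bound is attained for them: a pure translation gives
   the cylinder S^2 x R, with K = 2, and
   (t, u) |-> (u, c t u) in R^3 x R^3 (s' = 0, b = 0, c <> 0) has K = -2 at
   t = 0. *)
Definition proper_motion (R : realType) (s : R) (w b : nat -> R) : Prop :=
  s <> 0 \/
  (exists2 i : nat, (1 <= i <= 15)%N & w i <> 0) /\
  (exists2 i : nat, (1 <= i <= 7)%N & b i <> 0).

(* Only the points of the zero position where the parametrization is an
   immersion are considered: at the pole phi = pi/2 the metric is always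
   degenerate. *)
Definition has_constant_scalar_curvature (R : realType) (s : R)
  (w b : nat -> R) (K : R) : Prop :=
  let g := induced_metric (kinematic_surface s w b) in
  forall theta phi : R, 0 <= theta <= 2 * pi -> 0 <= phi <= pi ->
    g (point3 0 theta phi) \in unitmx ->
    scalar_curvature g (point3 0 theta phi) = K.

(* Main.v *)
(* Let u be the point of the starting sphere, omega the axis of the part of the
   infinitesimal motion inside the 3-space, beta = N^T b where N is the part
   leaving the 3-space, h = <beta, u>, z = <omega, u> and
   c^2 = omega_1^2 + ... + omega_6^2.  The roundness of the slices makes the
   velocity map conformal, so that the induced metric is
     (|b|^2 + s^2 + c^2 + 2h) dt^2 + 2 dt (<omega x u, du> + t dh)
       + ((1 + st)^2 + c^2 t^2) du^2,
   and at t = 0 its scalar curvature is F / (2 V^2) with V and F polynomials in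
   u, where V = D + 2h + z^2 and D = |b|^2 + s^2 + c^2 - |omega|^2.

   Constant curvature means F = 2 K V^2 wherever V does not vanish on the upper
   hemisphere.  On each meridian both sides are trigonometric polynomials, and V
   is not identically zero since V(u) + V(-u) > 0 for a proper motion; hence
   F = 2 K V^2 on the whole sphere.  If omega <> 0, the terms of degree 4 give
   K = 6, those of degree 3 give beta = 0, and those of degree 2 give
   D + 3 s^2 + 2 c^2 = 0, which is absurd.  If omega = 0 and beta <> 0, the
   terms of degree 2 give K = 3/2.  If both vanish, then
   K = 2 (|b|^2 - c^2) / (|b|^2 + s^2 + c^2). *)

Require Import Defs.
From mathcomp Require Import all_boot all_order all_algebra perm.
From mathcomp Require Import all_classical all_reals all_analysis.
From mathcomp Require Import ring lra.

Set Implicit Arguments.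
Unset Strict Implicit.
Unset Printing Implicit Defensive.

Import Order.TTheory GRing.Theory Num.Theory.
Import numFieldNormedType.Exports.

Local Open Scope ring_scope.

(** * Scalar curvature from the 2-jet of the metric *)

Lemma differentiable_bigD (R : realType) (V : normedModType R) (I : Type)
    (r : seq I) (F : I -> V -> R) (p : V) :
  (forall i, differentiable (F i) p) ->
  differentiable (fun q => \sum_(i <- r) F i q) p.
Proof.
move=> dF; elim: r => [|i r IHr].
  rewrite (_ : (fun _ => _) = cst 0); first exact: differentiable_cst.
  by apply/funext => q; rewrite big_nil.
rewrite (_ : (fun _ => _) = F i + (fun q => \sum_(i <- r) F i q)).
  exact: differentiableD.
by apply/funext => q; rewrite big_cons.
Qed.

Lemma differentiable_bigM (R : realType) (V : normedModType R) (I : Type)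
    (r : seq I) (F : I -> V -> R) (p : V) :
  (forall i, differentiable (F i) p) ->
  differentiable (fun q => \prod_(i <- r) F i q) p.
Proof.
move=> dF; elim: r => [|i r IHr].
  rewrite (_ : (fun _ => _) = cst 1); first exact: differentiable_cst.
  by apply/funext => q; rewrite big_nil.
rewrite (_ : (fun _ => _) = F i * (fun q => \prod_(i <- r) F i q)).
  exact: differentiableM.
by apply/funext => q; rewrite big_cons.
Qed.

Lemma differentiable_det (R : realType) (V : normedModType R) (n : nat)
    (g : V -> 'M[R]_n) (p : V) :
  (forall i j, differentiable (fun q => g q i j) p) ->
  differentiable (fun q => \det (g q)) p.
Proof.
move=> dg; rewrite /determinant.
apply: (@differentiable_bigD _ _ _ _
  (fun (s : 'S_n) q => (-1) ^+ s * \prod_i g q i (s i))) => s.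
apply: (@differentiableM _ _ (cst ((-1) ^+ s)) (fun q => \prod_i g q i (s i))).
  exact: differentiable_cst.
exact: differentiable_bigM.
Qed.

(** Invertibility is an open condition. Since [invmx] fixes singular matrices, formulas for the
    inverse can only be differentiated through such a neighbourhood. *)
Lemma near_unitmx (R : realType) (V : normedModType R) (n : nat)
    (g : V -> 'M[R]_n) (p : V) :
  (forall i j, differentiable (fun q => g q i j) p) -> g p \in unitmx ->
  \near p, g p \in unitmx.
Proof.
move=> dg; rewrite unitmxE unitfE => gp0.
have /differentiable_continuous dc := differentiable_det dg.
have : \forall q \near p, \det (g q) != 0.
  exact: cvgr_neq0 dc gp0.
by apply: filterS => q; rewrite unitmxE unitfE.
Qed.

Lemma differentiable_invmx (R : realType) (V : normedModType R) (n : nat)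
    (g : V -> 'M[R]_n) (p : V) (l m : 'I_n) :
  (forall i j, differentiable (fun q => g q i j) p) -> g p \in unitmx ->
  forall v, derivable (fun q => invmx (g q) l m) p v.
Proof.
move=> dg gp v.
have h : {near p, (fun q => (\det (g q))^-1 * cofactor (g q) m l)
                    =1 (fun q => invmx (g q) l m)}.
  apply: filterS (near_unitmx dg gp) => q gq.
  by rewrite /invmx gq !mxE.
apply: near_eq_derivable h _; apply: diff_derivable.
apply: (@differentiableM _ _ (fun q => (\det (g q))^-1)
  (fun q => cofactor (g q) m l)).
  apply: differentiableV; first exact: differentiable_det.
  by move: gp; rewrite unitmxE unitfE.
apply: (@differentiableM _ _ (cst _) (fun q => \det (row' m (col' l (g q))))).
  exact: differentiable_cst.
apply: differentiable_det => i j.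
rewrite (_ : (fun _ => _) = fun q => g q (lift m i) (lift l j)) //.
by apply/funext => q; rewrite !mxE.
Qed.

(** Differentiate [G *m g = 1] entrywise and multiply by the inverse on the right. *)
Lemma is_derive_invmx (R : realType) (V : normedModType R) (n : nat)
    (g : V -> 'M[R]_n) (p v : V) (dg : 'M[R]_n) (l m : 'I_n) :
  (forall i j, differentiable (fun q => g q i j) p) -> g p \in unitmx ->
  (forall i j, is_derive p v (fun q => g q i j) (dg i j)) ->
  is_derive p v (fun q => invmx (g q) l m)
    (- (invmx (g p) *m dg *m invmx (g p)) l m).
Proof.
move=> dgp gp hdg; apply: DeriveDef; first exact: differentiable_invmx.
pose G q := invmx (g q).
pose dG := \matrix_(i, j) 'D_v (fun q => G q i j) p.
suff : dG = - (G p *m dg *m G p).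
  by move=> /matrixP/(_ l m); rewrite !mxE.
suff : dG *m g p + G p *m dg = 0.
  move/eqP; rewrite addr_eq0 => /eqP e.
  by rewrite -[LHS](mulmxK gp) e mulNmx.
apply/matrixP => i j; rewrite [RHS]mxE.
have dE : is_derive p v (\sum_a ((fun q => G q i a) * (fun q => g q a j)))
    (\sum_a (G p i a *: dg a j + g p a j *: 'D_v (fun q => G q i a) p)).
  apply: is_derive_sum => a; apply: is_deriveM.
  exact/derivableP/differentiable_invmx.
(* The product of the two matrices is known to be the identity only near [p]. *)
have d0 : is_derive p v (\sum_a ((fun q => G q i a) * (fun q => g q a j))) 0.
  apply: near_eq_is_derive (is_derive_cst ((1%:M : 'M[R]_n) i j) p v).
  apply: filterS (near_unitmx dgp gp) => q gq.
  by rewrite -(mulVmx gq) mxE fct_sumE.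
have := @derive_val _ _ _ _ _ _ _ dE; rewrite derive_val => ->.
rewrite !mxE -big_split; apply: eq_bigr => a _ /=.
by rewrite /GRing.scale /= mxE addrC [X in _ + X = _]mulrC.
Qed.

Section Jet.
Variables (R : realType) (g : 'rV[R]_3 -> 'M[R]_3) (p : 'rV[R]_3).
Variables (dg : 'I_3 -> 'rV[R]_3 -> 'M[R]_3) (ddg : 'I_3 -> 'I_3 -> 'M[R]_3).
Hypothesis g_diff : forall i j, differentiable (fun q => g q i j) p.
Hypothesis g_unit : g p \in unitmx.
Hypothesis dgE : forall q k i j,
  is_derive q (delta_mx 0 k) (fun q => g q i j) (dg k q i j).
Hypothesis ddgE : forall l k i j,
  is_derive p (delta_mx 0 l) (fun q => dg k q i j) (ddg l k i j).

Let G := invmx (g p).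

Lemma christoffelE l i j q :
  christoffel g l i j q =
  2^-1 * \sum_(m < 3) invmx (g q) l m * (dg i q j m + dg j q i m - dg m q i j).
Proof.
have dE k a b : partial k (fun q => g q a b) q = dg k q a b.
  by rewrite /partial derive_val.
by congr (_ * _); apply: eq_bigr => m _; rewrite !dE.
Qed.

(* The derivative of [christoffel g l i j] along the [k]-th coordinate is this
   expression with its index [m] raised. *)
Definition christoffel_jet (k m i j : 'I_3) : R :=
  2^-1 * (ddg k i j m + ddg k j i m - ddg k m i j)
  - \sum_(n < 3) dg k p m n * christoffel g n i j p.

Lemma partial_christoffel k l i j :
  partial k (fun q => christoffel g l i j q) p =
  \sum_(m < 3) G l m * christoffel_jet k m i j.
Proof.
pose c m q := dg i q j m + dg j q i m - dg m q i j.
pose dc m := ddg k i j m + ddg k j i m - ddg k m i j.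
have dcE m : is_derive p (delta_mx 0 k) (c m) (dc m).
  by apply: is_deriveB; apply: is_deriveD.
have GE m : is_derive p (delta_mx 0 k) (fun q => invmx (g q) l m)
    (- (G *m dg k p *m G) l m).
  exact: is_derive_invmx.
rewrite /partial (_ : (fun q => _) =
    2^-1 \*: \sum_(m < 3) ((fun q => invmx (g q) l m) * c m)); last first.
  by apply/funext => q; rewrite christoffelE /= fct_sumE.
rewrite derive_val.
(* The derivative of [G] is [- G dg G]; its last factor, applied to half of [c], gives back the
   Christoffel symbols. *)
have -> : \sum_(m < 3) G l m * christoffel_jet k m i j =
    2^-1 * (\sum_(m < 3) G l m * dc m)
    - (G *m dg k p *m (\col_n christoffel g n i j p)) l 0.
  rewrite -mulmxA mxE mulr_sumr -sumrB; apply: eq_bigr => m _.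
  rewrite mulrBr mulrCA; congr (_ - _ * _).
  by rewrite mxE; apply: eq_bigr => n _; rewrite mxE.
have -> : \col_n christoffel g n i j p = 2^-1 *: (G *m \col_m c m p).
  apply/matrixP => n a; rewrite !mxE christoffelE; congr (_ * _).
  by apply: eq_bigr => m _; rewrite mxE.
rewrite -scalemxAr mulmxA !mxE -mulrBr; congr (_ * _).
rewrite -sumrB; apply: eq_bigr => m _.
by rewrite /GRing.scale /= !mxE mulrN [c m p * _]mulrC.
Qed.

(** The curvature depends only on the 2-jet of the metric, so what remains is algebra in [g p], [dg]
    and [ddg]. *)
Lemma scalar_curvature_jet :
  scalar_curvature g p =
  \sum_(i < 3) \sum_(j < 3) G i j *
    \sum_(l < 3) \sum_(m < 3)
      (G l m * (christoffel_jet l m i j - christoffel_jet j m i l)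
       + christoffel g l i j p * christoffel g m l m p
       - christoffel g m i l p * christoffel g l j m p).
Proof.
rewrite /scalar_curvature; apply: eq_bigr => i _; apply: eq_bigr => j _.
congr (_ * _); rewrite -sumrB -big_split -sumrB /=; apply: eq_bigr => l _.
rewrite !partial_christoffel -sumrB -big_split -sumrB /=.
by apply: eq_bigr => m _; rewrite [in RHS]mulrBr.
Qed.

End Jet.

(** * Derivatives of the coordinate frame of the sphere *)

Section LambdaDerive.
Context {R : realType} {V : normedModType R}.
Implicit Types (f g : V -> R) (p v : V).

(** These rules are phrased for pointwise expressions so that [derive_step] can follow the syntax of
    a function body. *)
Lemma is_derive_addf f g p v df dg : is_derive p v f df ->
  is_derive p v g dg -> is_derive p v (fun q => f q + g q) (df + dg).
Proof. exact: is_deriveD. Qed.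

Lemma is_derive_oppf f p v df :
  is_derive p v f df -> is_derive p v (fun q => - f q) (- df).
Proof. exact: is_deriveN. Qed.

Lemma is_derive_mulf f g p v df dg : is_derive p v f df ->
  is_derive p v g dg ->
  is_derive p v (fun q => f q * g q) (f p * dg + g p * df).
Proof. exact: is_deriveM. Qed.

Lemma is_derive_compf (F : R -> R) f p v dF df :
  is_derive (f p) 1 F dF -> differentiable f p -> is_derive p v f df ->
  is_derive p v (fun q => F (f q)) (dF * df).
Proof.
move=> [dF1 dFE] dfp [_ dfE].
have dFd : differentiable F (f p) by exact/derivable1_diffP.
apply: DeriveDef; first exact/diff_derivable/differentiable_comp.
rewrite deriveE; last exact: differentiable_comp.
rewrite diff_comp // /= -(deriveE _ dfp) dfE -dFE deriveE //.
by rewrite -[X in 'd _ _ X = _]mulr1 [LHS]linearZ mulrC.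
Qed.

Lemma differentiable_addf f g p : differentiable f p -> differentiable g p ->
  differentiable (fun q => f q + g q) p.
Proof. exact: differentiableD. Qed.

Lemma differentiable_oppf f p :
  differentiable f p -> differentiable (fun q => - f q) p.
Proof. exact: differentiableN. Qed.

Lemma differentiable_mulf f g p : differentiable f p -> differentiable g p ->
  differentiable (fun q => f q * g q) p.
Proof. exact: differentiableM. Qed.

Lemma differentiable_compf (F : R -> R) f p : derivable F (f p) 1 ->
  differentiable f p -> differentiable (fun q => F (f q)) p.
Proof. by move=> /derivable1_diffP dF df; exact: differentiable_comp. Qed.

End LambdaDerive.

Lemma is_derive_coord (R : realType) n (i : 'I_n.+1) (q v : 'rV[R]_n.+1) :
  is_derive q v (fun q : 'rV[R]_n.+1 => q 0 i) (v 0 i).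
Proof.
apply: DeriveDef; first exact/diff_derivable/differentiable_coord.
have := @is_derive_id R 'rV[R]_n.+1 q v => -[dq e].
have /matrixP/(_ 0 i) := derive_mx dq.
by rewrite e mxE.
Qed.

Lemma is_derive_cos_coord (R : realType) n (i : 'I_n.+1) (q v : 'rV[R]_n.+1) :
  is_derive q v (fun q : 'rV[R]_n.+1 => cos (q 0 i)) (- sin (q 0 i) * v 0 i).
Proof.
apply: (@is_derive_compf _ _ cos (fun q : 'rV[R]_n.+1 => q 0 i)).
  exact: differentiable_coord.
exact: is_derive_coord.
Qed.

Lemma is_derive_sin_coord (R : realType) n (i : 'I_n.+1) (q v : 'rV[R]_n.+1) :
  is_derive q v (fun q : 'rV[R]_n.+1 => sin (q 0 i)) (cos (q 0 i) * v 0 i).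
Proof.
apply: (@is_derive_compf _ _ sin (fun q : 'rV[R]_n.+1 => q 0 i)).
  exact: differentiable_coord.
exact: is_derive_coord.
Qed.

Lemma differentiable_cos_coord (R : realType) n (i : 'I_n.+1)
    (q : 'rV[R]_n.+1) :
  differentiable (fun q : 'rV[R]_n.+1 => cos (q 0 i)) q.
Proof.
apply: (@differentiable_compf _ _ cos (fun q : 'rV[R]_n.+1 => q 0 i)).
  exact: ex_derive.
exact: differentiable_coord.
Qed.

Lemma differentiable_sin_coord (R : realType) n (i : 'I_n.+1)
    (q : 'rV[R]_n.+1) :
  differentiable (fun q : 'rV[R]_n.+1 => sin (q 0 i)) q.
Proof.
apply: (@differentiable_compf _ _ sin (fun q : 'rV[R]_n.+1 => q 0 i)).
  exact: ex_derive.
exact: differentiable_coord.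
Qed.

Ltac derive_step :=
  first [ exact: is_derive_coord | exact: is_derive_cos_coord
        | exact: is_derive_sin_coord | exact: is_derive_cst
        | notypeclasses refine (is_derive_addf _ _)
        | notypeclasses refine (is_derive_oppf _)
        | notypeclasses refine (is_derive_mulf _ _) ].

(* [apply: is_derive_eq] would start a diverging instance search for the unknown
   derivative. *)
Ltac derive_with step :=
  notypeclasses refine (is_derive_eq _ _); [repeat step | rewrite /=].

Ltac derive_tac := derive_with derive_step.

Section Frame.
Variable R : realType.
Implicit Types (a : nat -> R) (th ph : R) (q v : 'rV[R]_3).

(* The components of [a] along the point of longitude [th] and latitude [ph] of
   the unit sphere and along the unit tangent vectors there. *)
Definition rad a th ph : R :=
  a 0%N * (cos th * cos ph) + a 1%N * (sin th * cos ph) + a 2%N * sin ph.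
Definition lon a th : R := a 1%N * cos th - a 0%N * sin th.
Definition lat a th ph : R :=
  a 2%N * cos ph - (a 0%N * cos th + a 1%N * sin th) * sin ph.

Lemma is_derive_rad a q v :
  is_derive q v (fun q => rad a (q 0 1) (q 0 2%:R))
    (v 0 1 * (cos (q 0 2%:R) * lon a (q 0 1))
     + v 0 2%:R * lat a (q 0 1) (q 0 2%:R)).
Proof. by rewrite /rad /lon /lat; derive_tac; ring. Qed.

Lemma is_derive_lon a q v :
  is_derive q v (fun q => lon a (q 0 1))
    (v 0 1 * (sin (q 0 2%:R) * lat a (q 0 1) (q 0 2%:R)
              - cos (q 0 2%:R) * rad a (q 0 1) (q 0 2%:R))).
Proof.
rewrite /rad /lon /lat; derive_tac.
(* [lon] does not involve the latitude; writing its derivative through [rad] and [lat] brings in the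
   Pythagorean identity there. *)
have := cos2Dsin2 (q 0 2%:R); set C := cos (q 0 2%:R); set S := sin (q 0 2%:R).
by move=> e; rewrite -[LHS]mulr1 -e; ring.
Qed.

Lemma is_derive_lat a q v :
  is_derive q v (fun q => lat a (q 0 1) (q 0 2%:R))
    (- (v 0 1 * (sin (q 0 2%:R) * lon a (q 0 1)))
     - v 0 2%:R * rad a (q 0 1) (q 0 2%:R)).
Proof. by rewrite /rad /lon /lat; derive_tac; ring. Qed.
End Frame.

(** * The induced metric *)

(** Indices are plain naturals, with everything from 2 on read as 2, so that entries reduce by
    computation. *)
Definition sym3 (T : Type) (a00 a01 a02 a11 a12 a22 : T) (i j : nat) : T :=
  match i, j with
  | 0, 0 => a00
  | 0, 1 | 1, 0 => a01
  | 0, _ | _, 0 => a02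
  | 1, 1 => a11
  | 1, _ | _, 1 => a12
  | _, _ => a22
  end.

Section InducedMetric.
Variables (R : realType) (s : R) (w b : nat -> R).

(* [beta] is the transpose of [velo] applied to [b]; [omega] is the axis of the
   skew part of the first three components of [velo]. *)
Definition omega (i : nat) : R := [:: - w 7%N; w 2%N; - w 1%N]`_i.
Definition beta (i : nat) : R :=
  [:: - (w 3%N * b 4%N + w 4%N * b 5%N + w 5%N * b 6%N + w 6%N * b 7%N);
      - (w 8%N * b 4%N + w 9%N * b 5%N + w 10%N * b 6%N + w 11%N * b 7%N);
      - (w 12%N * b 4%N + w 13%N * b 5%N + w 14%N * b 6%N + w 15%N * b 7%N)]`_i.

Definition normb : R := b 4%N ^+ 2 + b 5%N ^+ 2 + b 6%N ^+ 2 + b 7%N ^+ 2.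
Definition rotw : R := w 1%N ^+ 2 + w 2%N ^+ 2 + w 3%N ^+ 2
  + w 4%N ^+ 2 + w 5%N ^+ 2 + w 6%N ^+ 2.

(* The surface is [t *: vb b + incl u + t *: velo u] for [u] in the unit
   sphere. *)
Definition incl (x : nat -> R) : 'rV[R]_7 :=
  vec7 [:: x 0%N; x 1%N; x 2%N; 0; 0; 0; 0].
Definition velo (x : nat -> R) : 'rV[R]_7 :=
  vec7 [:: s * x 0%N + w 1%N * x 1%N + w 2%N * x 2%N;
           s * x 1%N - w 1%N * x 0%N + w 7%N * x 2%N;
           s * x 2%N - w 2%N * x 0%N - w 7%N * x 1%N;
           - (w 3%N * x 0%N + w 8%N * x 1%N + w 12%N * x 2%N);
           - (w 4%N * x 0%N + w 9%N * x 1%N + w 13%N * x 2%N);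
           - (w 5%N * x 0%N + w 10%N * x 1%N + w 14%N * x 2%N);
           - (w 6%N * x 0%N + w 11%N * x 1%N + w 15%N * x 2%N)].

Definition dot3 (x y : nat -> R) : R :=
  x 0%N * y 0%N + x 1%N * y 1%N + x 2%N * y 2%N.
Definition det3 (x y z : nat -> R) : R :=
  (x 1%N * y 2%N - x 2%N * y 1%N) * z 0%N
  + (x 2%N * y 0%N - x 0%N * y 2%N) * z 1%N
  + (x 0%N * y 1%N - x 1%N * y 0%N) * z 2%N.

Lemma dotvC n (x y : 'rV[R]_n) : dotv x y = dotv y x.
Proof. by apply: eq_bigr => k _; rewrite mulrC. Qed.

Lemma dotvDl n (x y z : 'rV[R]_n) : dotv (x + y) z = dotv x z + dotv y z.
Proof. by rewrite -big_split; apply: eq_bigr => k _; rewrite mxE mulrDl. Qed.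

Lemma dotvZl n c (x z : 'rV[R]_n) : dotv (c *: x) z = c * dotv x z.
Proof. by rewrite mulr_sumr; apply: eq_bigr => k _; rewrite mxE mulrA. Qed.

Lemma dotvDr n (x y z : 'rV[R]_n) : dotv z (x + y) = dotv z x + dotv z y.
Proof. by rewrite !(dotvC z) dotvDl. Qed.

Lemma dotvZr n c (x z : 'rV[R]_n) : dotv z (c *: x) = c * dotv z x.
Proof. by rewrite !(dotvC z) dotvZl. Qed.

Lemma dotv7 (x y : seq R) :
  dotv (vec7 x) (vec7 y) = x`_0 * y`_0 + x`_1 * y`_1 + x`_2 * y`_2
    + x`_3 * y`_3 + x`_4 * y`_4 + x`_5 * y`_5 + x`_6 * y`_6.
Proof. by rewrite /dotv !big_ord_recr big_ord0 /= !mxE /= add0r. Qed.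

Hypothesis hround : round_slices w.
Hypothesis hb : no_inner_translation b.

Lemma dotv_bb : dotv (vb b) (vb b) = normb.
Proof. by case: hb => b1 b2 b3; rewrite dotv7 /= b1 b2 b3 /normb; ring. Qed.

Lemma dotv_b_incl x : dotv (vb b) (incl x) = 0.
Proof. by case: hb => b1 b2 b3; rewrite dotv7 /= b1 b2 b3; ring. Qed.

Lemma dotv_b_velo x : dotv (vb b) (velo x) = dot3 beta x.
Proof.
by case: hb => b1 b2 b3; rewrite dotv7 /= b1 b2 b3 /dot3 /beta /=; ring.
Qed.

Lemma dotv_incl x y : dotv (incl x) (incl y) = dot3 x y.
Proof. by rewrite dotv7 /= /dot3; ring. Qed.

Lemma dotv_velo_incl x y :
  dotv (velo x) (incl y) = s * dot3 x y + det3 omega x y.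
Proof. by rewrite dotv7 /= /dot3 /det3 /omega /=; ring. Qed.

Lemma round_slicesE :
  [/\ w 2%N * w 7%N + w 3%N * w 8%N + w 4%N * w 9%N + w 5%N * w 10%N
        + w 6%N * w 11%N = 0,
      w 1%N * w 7%N = w 3%N * w 12%N + w 4%N * w 13%N + w 5%N * w 14%N
        + w 6%N * w 15%N,
      w 1%N * w 2%N + w 8%N * w 12%N + w 9%N * w 13%N + w 10%N * w 14%N
        + w 11%N * w 15%N = 0,
      rotw = w 1%N ^+ 2 + w 7%N ^+ 2 + w 8%N ^+ 2 + w 9%N ^+ 2 + w 10%N ^+ 2
        + w 11%N ^+ 2 &
      rotw = w 2%N ^+ 2 + w 7%N ^+ 2 + w 12%N ^+ 2 + w 13%N ^+ 2
        + w 14%N ^+ 2 + w 15%N ^+ 2].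
Proof.
have := hround; rewrite /round_slices /index_iota /=.
rewrite !big_cons !big_nil /= !addr0 => -[e1 e2 e3 e4 e5].
split; [lra|lra|lra| |]; rewrite /rotw; lra.
Qed.

(** The velocity map is conformal: its [s = 0] part is so by roundness, and the cross terms with [s]
    cancel by skew symmetry. *)
Lemma dotv_velo x y : dotv (velo x) (velo y) = (s ^+ 2 + rotw) * dot3 x y.
Proof.
have [e1 e2 e3 e4 e5] := round_slicesE.
apply/eqP; rewrite -subr_eq0; apply/eqP.
pose E1 := w 2%N * w 7%N + w 3%N * w 8%N + w 4%N * w 9%N + w 5%N * w 10%N
        + w 6%N * w 11%N.
pose E2 := w 3%N * w 12%N + w 4%N * w 13%N + w 5%N * w 14%N
        + w 6%N * w 15%N - w 1%N * w 7%N.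
pose E3 := w 1%N * w 2%N + w 8%N * w 12%N + w 9%N * w 13%N + w 10%N * w 14%N
        + w 11%N * w 15%N.
pose E4 := w 1%N ^+ 2 + w 7%N ^+ 2 + w 8%N ^+ 2 + w 9%N ^+ 2 + w 10%N ^+ 2
        + w 11%N ^+ 2 - rotw.
pose E5 := w 2%N ^+ 2 + w 7%N ^+ 2 + w 12%N ^+ 2 + w 13%N ^+ 2
        + w 14%N ^+ 2 + w 15%N ^+ 2 - rotw.
transitivity ((x 0%N * y 1%N + x 1%N * y 0%N) * E1
  + (x 0%N * y 2%N + x 2%N * y 0%N) * E2
  + (x 1%N * y 2%N + x 2%N * y 1%N) * E3
  + x 1%N * y 1%N * E4 + x 2%N * y 2%N * E5).
  by rewrite dotv7 /= /E1 /E2 /E3 /E4 /E5 /dot3 /rotw; ring.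
by rewrite /E1 /E2 /E3 /E4 /E5 e1 e3 -e4 -e5 e2; ring.
Qed.

Definition sph (th ph : R) (i : nat) : R :=
  [:: cos th * cos ph; sin th * cos ph; sin ph]`_i.
Definition sph_th (th ph : R) (i : nat) : R :=
  [:: - sin th * cos ph; cos th * cos ph; 0]`_i.
Definition sph_ph (th ph : R) (i : nat) : R :=
  [:: - cos th * sin ph; - sin th * sin ph; cos ph]`_i.

Lemma is_derive_kinematic (q v : 'rV[R]_3) (k : 'I_7) :
  let t := q 0 0 in let th := q 0 1 in let ph := q 0 2%:R in
  is_derive q v (fun q => kinematic_surface s w b q 0 k)
    ((v 0 0 *: (vb b + velo (sph th ph))
      + v 0 1 *: (incl (sph_th th ph) + t *: velo (sph_th th ph))
      + v 0 2%:R *: (incl (sph_ph th ph) + t *: velo (sph_ph th ph))) 0 k).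
Proof.
rewrite /= !mxE; under eq_fun do rewrite !mxE /=.
case: k => -[|[|[|[|[|[|[|//]]]]]]] hk /=; derive_tac;
rewrite /sph /sph_th /sph_ph /=; ring.
Qed.

Lemma partial_kinematic (q : 'rV[R]_3) (i : 'I_3) :
  let t := q 0 0 in let th := q 0 1 in let ph := q 0 2%:R in
  let v := delta_mx 0 i : 'rV[R]_3 in
  partial i (kinematic_surface s w b) q =
  v 0 0 *: (vb b + velo (sph th ph))
      + v 0 1 *: (incl (sph_th th ph) + t *: velo (sph_th th ph))
      + v 0 2%:R *: (incl (sph_ph th ph) + t *: velo (sph_ph th ph)).
Proof.
move=> t th ph v; have dk := is_derive_kinematic q v.
rewrite /partial derive_mx; last first.
  by apply/derivable_mxP => j k; rewrite (ord1 j); case: (dk k).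
by apply/matrixP => j k; rewrite (ord1 j) mxE derive_val.
Qed.

(** [rho] is the conformal factor of the slice at time [t]: [incl x + t *: velo x] has squared
    length [rho * dot3 x x]. *)
Definition metric (t th ph : R) : nat -> nat -> R :=
  let rho := 1 + 2 * s * t + (s ^+ 2 + rotw) * (t * t) in
  sym3 (normb + s ^+ 2 + rotw + 2 * rad beta th ph)
    (cos ph * (lat omega th ph + t * lon beta th))
    (t * lat beta th ph - lon omega th)
    (rho * (cos ph * cos ph)) 0 rho.

Lemma induced_metricE :
  induced_metric (kinematic_surface s w b) =
  fun q => \matrix_(i, j) metric (q 0 0) (q 0 1) (q 0 2%:R) i j.
Proof.
apply/funext => q; apply/matrixP => i j; rewrite !mxE !partial_kinematic.
have := cos2Dsin2 (q 0 2%:R); have := cos2Dsin2 (q 0 1).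
set th := q 0 1; set ph := q 0 2%:R; set t := q 0 0.
move=> eth eph.
have uu : dot3 (sph th ph) (sph th ph) = 1.
  (* Units are replaced by sums of squares of cosine and sine until both sides agree as polynomials;
     several identities below follow the same pattern. *)
  rewrite -eph -[cos ph ^+ 2]mulr1 -eth /dot3 /sph /=; ring.
have ut : dot3 (sph th ph) (sph_th th ph) = 0.
  rewrite /dot3 /sph /sph_th /=; ring.
have up : dot3 (sph th ph) (sph_ph th ph) = 0.
  transitivity (cos ph * sin ph * (1 - (cos th ^+ 2 + sin th ^+ 2))).
    by rewrite /dot3 /sph /sph_ph /=; ring.
  by rewrite eth subrr mulr0.
have tt : dot3 (sph_th th ph) (sph_th th ph) = cos ph * cos ph.
  rewrite -[RHS]mul1r -eth /dot3 /sph_th /=; ring.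
have tp : dot3 (sph_th th ph) (sph_ph th ph) = 0.
  rewrite /dot3 /sph_ph /sph_th /=; ring.
have pp : dot3 (sph_ph th ph) (sph_ph th ph) = 1.
  rewrite -eph -[sin ph ^+ 2]mulr1 -eth /dot3 /sph_ph /=; ring.
have dC x y : dot3 x y = dot3 y x by rewrite /dot3; ring.
have det0 x y : det3 omega x y = - det3 omega y x by rewrite /det3; ring.
have dut : det3 omega (sph th ph) (sph_th th ph) = cos ph * lat omega th ph.
  rewrite /lat -[omega 2]mulr1 -eth /det3 /sph /sph_th /=; ring.
have dup : det3 omega (sph th ph) (sph_ph th ph) = - lon omega th.
  rewrite -[lon _ _]mulr1 -eph /lon /det3 /sph /sph_ph /=; ring.
have bu : dot3 beta (sph th ph) = rad beta th ph.
  by rewrite /dot3 /rad /sph /=.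
have bt : dot3 beta (sph_th th ph) = cos ph * lon beta th.
  rewrite /dot3 /lon /sph_th /=; ring.
have bp : dot3 beta (sph_ph th ph) = lat beta th ph.
  rewrite /dot3 /lat /sph_ph /=; ring.
rewrite !(dotvDl, dotvDr, dotvZl, dotvZr) dotv_bb !(dotvC (incl _) (vb _))
  !(dotvC (velo _) (vb _)) !(dotvC (incl _) (velo _)).
rewrite !(dotv_velo_incl, dotv_incl, dotv_velo, dotv_b_velo, dotv_b_incl).
rewrite (dC (sph_th th ph) (sph th ph)) (dC (sph_ph th ph) (sph th ph)).
rewrite (dC (sph_ph th ph) (sph_th th ph)) uu ut up tt tp pp.
rewrite dut dup bu bt bp.
have dxx x : det3 omega x x = 0 by rewrite /det3; ring.
rewrite !dxx (det0 (sph_ph _ _) (sph_th _ _)).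
(* This determinant occurs in the mixed angular entry with both signs and cancels, so its value is
   irrelevant. *)
move: (det3 omega (sph_th _ _) _) => dtp.
case: i j => -[|[|[|//]]] hi [] [|[|[|//]]] hj;
  rewrite /metric !mxE /= -/th -/ph -/t; ring.
Qed.

End InducedMetric.

(** * Scalar curvature at the zero position *)

Section MetricDerivatives.
Variables (R : realType) (s : R) (w b : nat -> R).

Let om := omega w.
Let be := beta w b.
Let e := s ^+ 2 + rotw w.

Definition dmetric (t th ph : R) (k : nat) : nat -> nat -> R :=
  let C := cos ph in let S := sin ph in
  let h := rad be th ph in let h1 := lon be th in let h2 := lat be th ph in
  let z := rad om th ph in let z1 := lon om th in let z2 := lat om th ph in
  match k with
  | 0 => sym3 0 (C * h1) h2 ((2 * s + 2 * e * t) * (C * C)) 0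
           (2 * s + 2 * e * t)
  | 1 => sym3 (2 * (C * h1)) (C * (t * (S * h2 - C * h) - S * z1))
           (C * z - S * z2 - t * (S * h1)) 0 0 0
  | _ => sym3 (2 * h2) (- (S * (z2 + t * h1)) - C * z) (- (t * h))
           (- ((1 + 2 * s * t + e * (t * t)) * (2 * (C * S)))) 0 0
  end.

(** Second derivatives at [t = 0] only. The outer [sym3] runs over the two directions of
    differentiation. Sums such as [S * S + C * C] stay unreduced so that [ring] can check the
    derivatives. *)
Definition ddmetric (th ph : R) (l k : nat) : nat -> nat -> R :=
  let C := cos ph in let S := sin ph in
  let h := rad be th ph in let h1 := lon be th in let h2 := lat be th ph in
  let z := rad om th ph in let z1 := lon om th in let z2 := lat om th ph in
  sym3 (sym3 0 0 0 (2 * e * (C * C)) 0 (2 * e))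
    (sym3 0 (C * (S * h2 - C * h)) (- (S * h1)) 0 0 0)
    (sym3 0 (- (S * h1)) (- h) (- (4 * s * (C * S))) 0 0)
    (sym3 (2 * (C * (S * h2 - C * h))) (C * (S * (C * z - S * z2)))
       ((S * S + C * C) * z1) 0 0 0)
    (sym3 (- (2 * (S * h1))) ((S * S - C * C) * z1) 0 0 0 0)
    (sym3 (- (2 * h)) (2 * (S * z - C * z2)) 0 (2 * (S * S - C * C)) 0 0) l k.

Ltac metric_step :=
  first [ exact: is_derive_rad | exact: is_derive_lon | exact: is_derive_lat
        | derive_step ].

Lemma is_derive_metric (q : 'rV[R]_3) (k : 'I_3) (i j : nat) :
  is_derive q (delta_mx 0 k)
    (fun q : 'rV[R]_3 => metric s w b (q 0 0) (q 0 1) (q 0 2%:R) i j)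
    (dmetric (q 0 0) (q 0 1) (q 0 2%:R) k i j).
Proof.
case: k => -[|[|[|//]]] hk; case: i j => [|[|i]] [|[|j]];
  rewrite /metric /dmetric /= -/om -/be -/e; derive_with metric_step;
  rewrite ?mxE /=; ring.
Qed.

Lemma differentiable_metric (q : 'rV[R]_3) (i j : nat) :
  differentiable
    (fun q : 'rV[R]_3 => metric s w b (q 0 0) (q 0 1) (q 0 2%:R) i j) q.
Proof.
case: i j => [|[|i]] [|[|j]]; rewrite /metric /= /rad /lon /lat;
  repeat first [ exact: differentiable_coord | exact: differentiable_cst
    | exact: differentiable_cos_coord
    | exact: differentiable_sin_coord
    | notypeclasses refine (differentiable_addf _ _)
    | notypeclasses refine (differentiable_oppf _)
    | notypeclasses refine (differentiable_mulf _ _) ].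
Qed.

Lemma is_derive_dmetric (q : 'rV[R]_3) (l k : 'I_3) (i j : nat) :
  q 0 0 = 0 ->
  is_derive q (delta_mx 0 l)
    (fun q : 'rV[R]_3 => dmetric (q 0 0) (q 0 1) (q 0 2%:R) k i j)
    (ddmetric (q 0 1) (q 0 2%:R) l k i j).
Proof.
move=> q0.
case: l k => -[|[|[|//]]] hl [] [|[|[|//]]] hk; case: i j => [|[|i]] [|[|j]];
  rewrite /ddmetric /dmetric /= -/om -/be -/e; derive_with metric_step;
  rewrite ?mxE /= ?q0; ring.
Qed.

End MetricDerivatives.

Section ZeroPosition.
Variables (R : realType) (s : R) (w b : nat -> R) (th ph : R).

Let om := omega w.
Let be := beta w b.
Let e := s ^+ 2 + rotw w.
Let C := cos ph.
Let S := sin ph.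
Let h := rad be th ph.
Let h1 := lon be th.
Let h2 := lat be th ph.
Let z := rad om th ph.
Let z1 := lon om th.
Let z2 := lat om th ph.
Let V := normb b + e + 2 * h - z1 ^+ 2 - z2 ^+ 2.

Let p := point3 0 th ph.
Let g (q : 'rV[R]_3) : 'M[R]_3 :=
  \matrix_(i, j) metric s w b (q 0 0) (q 0 1) (q 0 2%:R) i j.
Let dg (k : 'I_3) (q : 'rV[R]_3) : 'M[R]_3 :=
  \matrix_(i, j) dmetric s w b (q 0 0) (q 0 1) (q 0 2%:R) k i j.

(** The inverse of the metric at [t = 0], whose determinant is [C ^+ 2 * V]. *)
Definition cometric : nat -> nat -> R :=
  sym3 (1 / V) (- z2 / (C * V)) (z1 / V)
    (1 / C ^+ 2 + z2 ^+ 2 / (C ^+ 2 * V)) (- (z1 * z2) / (C * V))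
    (1 + z1 ^+ 2 / V).

Definition christoffel0 (n : nat) : nat -> nat -> R :=
  let y1 := z * z1 + h1 - s * z2 in let y2 := z * z2 + h2 + s * z1 in
  match n with
  | 0 => sym3 0 (C * y1 / V) (y2 / V) (- (C ^+ 2 * s) / V) 0 (- s / V)
  | 1 => sym3 0 (s - z2 * y1 / V) (- (z2 * y2 / V + z) / C)
           (C * z2 * s / V) (- S / C) (z2 * s / (V * C))
  | _ => sym3 0 (C * (z1 * y1 / V + z)) (z1 * y2 / V + s)
           (C * S - C ^+ 2 * z1 * s / V) 0 (- (z1 * s) / V)
  end.

Hypothesis C_neq0 : C != 0.
Hypothesis V_neq0 : V != 0.

Let p0 : p 0 0 = 0. Proof. by rewrite mxE. Qed.
Let p1 : p 0 1 = th. Proof. by rewrite mxE. Qed.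
Let p2 : p 0 2%:R = ph. Proof. by rewrite mxE. Qed.

Lemma mul_cometric : (\matrix_(i < 3, j < 3) cometric i j) *m g p = 1%:M.
Proof.
have g00 : normb b + s ^+ 2 + rotw w + 2 * h = V + z1 ^+ 2 + z2 ^+ 2.
  by rewrite /V /e; ring.
apply/matrixP => i j; rewrite !mxE !big_ord_recl big_ord0 !mxE.
case: i j => -[|[|[|//]]] hi [] [|[|[|//]]] hj;
  rewrite /cometric /metric /= -/om -/be -/e -/C -/h -/h1 -/h2 -/z -/z1 -/z2.
all: rewrite ?g00; field; by rewrite C_neq0 V_neq0.
Qed.

Lemma metric_unit : g p \in unitmx.
Proof. by case: (mulmx1_unit mul_cometric). Qed.

Lemma invmx_metric : invmx (g p) = \matrix_(i < 3, j < 3) cometric i j.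
Proof.
by rewrite -[LHS]mul1mx -mul_cometric -mulmxA (mulmxV metric_unit) mulmx1.
Qed.

Let dgE q (k i j : 'I_3) :
  is_derive q (delta_mx 0 k) (fun q => g q i j) (dg k q i j).
Proof.
by under eq_fun do rewrite mxE; rewrite mxE; exact: is_derive_metric.
Qed.

Lemma christoffel_metric (n i j : 'I_3) :
  christoffel g n i j p = christoffel0 n i j.
Proof.
rewrite (christoffelE dgE) invmx_metric !big_ord_recl big_ord0 !mxE.
case: n i j => -[|[|[|//]]] hn [] [|[|[|//]]] hi [] [|[|[|//]]] hj;
  rewrite /cometric /dmetric /christoffel0 /= -/om -/be -/e -/C -/S -/h -/h1
    -/h2 -/z -/z1 -/z2;
  by field; rewrite C_neq0 V_neq0.
Qed.

Let ddg (l k : 'I_3) : 'M[R]_3 := \matrix_(i, j) ddmetric s w b th ph l k i j.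

Let ddgE (l k i j : 'I_3) :
  is_derive p (delta_mx 0 l) (fun q => dg k q i j) (ddg l k i j).
Proof.
under eq_fun do rewrite mxE; rewrite mxE.
by have := @is_derive_dmetric _ s w b p l k i j p0; rewrite p1 p2.
Qed.

Let g_diff (i j : 'I_3) : differentiable (fun q => g q i j) p.
Proof. by under eq_fun do rewrite mxE; exact: differentiable_metric. Qed.

(** The Ricci tensor at [p]. Passing through this closed form splits one large rational identity
    into nine entries and a final contraction. *)
Definition ricci0 : nat -> nat -> R :=
  let g1 := z * z1 + h1 in let g2 := z * z2 + h2 in
  let r2 := z1 ^+ 2 + z2 ^+ 2 in
  let d := h1 * z2 - h2 * z1 in
  let sg := s ^+ 2 * r2 - 2 * s * d in
  sym3
    ((r2 * sg + d ^+ 2) / V ^+ 2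
     + (r2 * (s ^+ 2 - e + z ^+ 2) + sg + g1 ^+ 2 + g2 ^+ 2) / V
     + 2 * (s ^+ 2 - e + z ^+ 2))
    (C * ((z2 * sg + g1 * d) / V ^+ 2 + (z2 * (z ^+ 2 - e) + s * g1) / V + z2))
    ((g2 * d - z1 * sg) / V ^+ 2 + (s * g2 - z1 * (z ^+ 2 - e)) / V - z1)
    (C ^+ 2 * ((sg + g1 ^+ 2) / V ^+ 2 + (z ^+ 2 - z1 ^+ 2 - e) / V + 1))
    (C * (g1 * g2 / V ^+ 2 - z1 * z2 / V))
    ((sg + g2 ^+ 2) / V ^+ 2 + (z ^+ 2 - z2 ^+ 2 - e) / V + 1).

Definition sum3 (F : nat -> R) : R := F 0%N + F 1%N + F 2%N.

Lemma sum3E (F : nat -> R) : \sum_(i < 3) F i = sum3 F.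
Proof. by rewrite !big_ord_recr big_ord0 /= add0r. Qed.

Definition christoffel_jet0 (k m i j : nat) : R :=
  2^-1 * (ddmetric s w b th ph k i j m + ddmetric s w b th ph k j i m
          - ddmetric s w b th ph k m i j)
  - sum3 (fun n => dmetric s w b 0 th ph k m n * christoffel0 n i j).

Lemma christoffel_jet_metric (k m i j : 'I_3) :
  christoffel_jet g p dg ddg k m i j = christoffel_jet0 k m i j.
Proof.
rewrite /christoffel_jet /christoffel_jet0 -sum3E !mxE; congr (_ - _).
by apply: eq_bigr => n _; rewrite christoffel_metric mxE p0 p1 p2.
Qed.

Lemma ricci0E (i j : 'I_3) :
  sum3 (fun l => sum3 (fun m =>
    (cometric l m * (christoffel_jet0 l m i j - christoffel_jet0 j m i l)
     + christoffel0 l i j * christoffel0 m l m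
     - christoffel0 m i l * christoffel0 l j m))) = ricci0 i j.
Proof.
case: i j => -[|[|[|//]]] hi [] [|[|[|//]]] hj.
all: cbv beta iota zeta delta [sum3 sym3 cometric christoffel0 christoffel_jet0
  dmetric ddmetric ricci0 nat_of_ord].
all: fold om be e C S; fold h h1 h2 z z1 z2.
all: by field; rewrite C_neq0 V_neq0.
Qed.

(** Clearing [V ^+ 2] leaves a polynomial in the frame components; [C], which vanishes at the poles,
    has cancelled. *)
Lemma scalar_curvature_metric :
  2 * V ^+ 2 * scalar_curvature g p =
  4 * V ^+ 2 - 2 * V * (2 * (z1 ^+ 2 + z2 ^+ 2) - 4 * h - 4 * z ^+ 2)
  + 4 * ((h1 + z * z1) ^+ 2 + (h2 + z * z2) ^+ 2)
  - 4 * V * (s ^+ 2 + 2 * rotw w + 2 * h)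
  + 8 * s * (s * (z1 ^+ 2 + z2 ^+ 2) - 2 * (z2 * h1 - z1 * h2)).
Proof.
have -> : scalar_curvature g p =
    sum3 (fun i => sum3 (fun j => cometric i j * ricci0 i j)).
  rewrite (scalar_curvature_jet g_diff metric_unit dgE ddgE) -sum3E.
  apply: eq_bigr => i _; rewrite -sum3E; apply: eq_bigr => j _.
  rewrite -ricci0E invmx_metric mxE -sum3E; congr (_ * _).
  apply: eq_bigr => l _; rewrite -sum3E; apply: eq_bigr => m _.
  by rewrite !christoffel_jet_metric !christoffel_metric mxE.
have -> : rotw w = e - s ^+ 2 by rewrite /e; ring.
cbv beta iota zeta delta [sum3 sym3 cometric ricci0].
by field; rewrite C_neq0 V_neq0.
Qed.

End ZeroPosition.

(** * Coordinate-free form of the curvature at the zero position *)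

Section FrameIdentities.
Variables (R : realType) (th ph : R).
Implicit Types x y : nat -> R.

Lemma rad_dot3 x : rad x th ph = dot3 x (sph th ph).
Proof. by []. Qed.

(** [rad], [lon] and [lat] are components in an orthonormal frame, obtained by a rotation through
    [th] followed by one through [ph]. *)
Lemma dot3_frame x y : dot3 x y = rad x th ph * rad y th ph
  + lon x th * lon y th + lat x th ph * lat y th ph.
Proof.
pose r x := x 0%N * cos th + x 1%N * sin th.
transitivity ((r x * r y + x 2%N * y 2%N) * (cos ph ^+ 2 + sin ph ^+ 2)
    + lon x th * lon y th).
  transitivity ((x 0%N * y 0%N + x 1%N * y 1%N) * (cos th ^+ 2 + sin th ^+ 2)
      + x 2%N * y 2%N).
    by rewrite cos2Dsin2 mulr1.
  by rewrite (cos2Dsin2 ph) /r /lon; ring.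
by rewrite /r /rad /lon /lat; ring.
Qed.

(** The frame of radial, longitude and latitude directions is right-handed. *)
Lemma det3_frame x y :
  det3 x (sph th ph) y = lat x th ph * lon y th - lon x th * lat y th ph.
Proof.
have eth := cos2Dsin2 th.
transitivity (sin ph * (cos th ^+ 2 + sin th ^+ 2)
    * (x 1%N * y 0%N - x 0%N * y 1%N) + cos ph * (
     x 2%N * (cos th * y 1%N - sin th * y 0%N)
     + (x 0%N * sin th - x 1%N * cos th) * y 2%N)).
  by rewrite eth /det3 /sph /=; ring.
by rewrite /lon /lat; ring.
Qed.

End FrameIdentities.

Section CurvatureForm.
Variables (R : realType) (s : R) (w b : nat -> R).

(* The squared norm of the component of the velocity of [u] at [t = 0] that is
   normal to the sphere. *)
Definition lapse2 (u : nat -> R) : R :=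
  normb b + s ^+ 2 + rotw w - dot3 (omega w) (omega w)
  + 2 * dot3 (beta w b) u + dot3 (omega w) u ^+ 2.

(** The right-hand side of [scalar_curvature_metric] with tangential components eliminated, as in
    [z1 ^+ 2 + z2 ^+ 2 = dot3 om om - z ^+ 2]; it makes sense at every [u], poles included. *)
Definition curvature_form (u : nat -> R) : R :=
  let V := lapse2 u in
  let om := omega w in let be := beta w b in
  let h := dot3 be u in let z := dot3 om u in
  4 * V ^+ 2 - 2 * V * (2 * dot3 om om - 4 * h - 6 * z ^+ 2)
  + 4 * (dot3 be be - h ^+ 2) + 8 * z * (dot3 om be - z * h)
  + 4 * z ^+ 2 * (dot3 om om - z ^+ 2)
  - 4 * V * (s ^+ 2 + 2 * rotw w + 2 * h)
  + 8 * s * (s * (dot3 om om - z ^+ 2) - 2 * det3 om u be).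

Lemma kinematic_curvature (th ph : R) : round_slices w ->
  no_inner_translation b -> cos ph != 0 -> lapse2 (sph th ph) != 0 ->
  let g := induced_metric (kinematic_surface s w b) in
  g (point3 0 th ph) \in unitmx /\
  2 * lapse2 (sph th ph) ^+ 2 * scalar_curvature g (point3 0 th ph)
    = curvature_form (sph th ph).
Proof.
move=> hr hb C0 V0 g.
have V0E : lapse2 (sph th ph) = normb b + (s ^+ 2 + rotw w)
    + 2 * rad (beta w b) th ph - lon (omega w) th ^+ 2
    - lat (omega w) th ph ^+ 2.
  by rewrite /lapse2 (dot3_frame th ph (omega w)) -!rad_dot3; ring.
have V1 := V0; rewrite V0E in V1.
rewrite /g (induced_metricE s hr hb); split; first exact: metric_unit.
rewrite /curvature_form [X in 2 * X ^+ 2]V0E scalar_curvature_metric //.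
rewrite -V0E det3_frame -!rad_dot3.
rewrite (dot3_frame th ph (omega w) (omega w)).
rewrite (dot3_frame th ph (beta w b) (beta w b)).
rewrite (dot3_frame th ph (omega w) (beta w b)).
ring.
Qed.
End CurvatureForm.

(** * Extension of the curvature equation to the whole sphere *)

Section HalfAngle.
Variable R : realType.
Implicit Types (f g : R -> R) (x c : R).

(* A trigonometric polynomial in an angle, written in the tangent [x] of its
   half. *)
Definition half_angle_poly f :=
  exists n (p : {poly R}), forall x, f x * (1 + x ^+ 2) ^+ n = p.[x].

Lemma add1sqr_gt0 x : 0 < 1 + x ^+ 2.
Proof. by rewrite ltr_pwDl // sqr_ge0. Qed.

Lemma half_angle_poly_cst c : half_angle_poly (fun=> c).
Proof. by exists 0%N, c%:P => x; rewrite expr0 mulr1 hornerC. Qed.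

Lemma half_angle_polyD f g : half_angle_poly f -> half_angle_poly g ->
  half_angle_poly (fun x => f x + g x).
Proof.
move=> [n [p pE]] [m [q qE]].
exists (n + m)%N, (p * (1 + 'X^2) ^+ m + q * (1 + 'X^2) ^+ n) => x.
by rewrite !hornerE -pE -qE exprD; ring.
Qed.

Lemma half_angle_polyM f g : half_angle_poly f -> half_angle_poly g ->
  half_angle_poly (fun x => f x * g x).
Proof.
move=> [n [p pE]] [m [q qE]]; exists (n + m)%N, (p * q) => x.
by rewrite hornerM -pE -qE exprD; ring.
Qed.

Lemma half_angle_polyN f :
  half_angle_poly f -> half_angle_poly (fun x => - f x).
Proof.
by move=> [n [p pE]]; exists n, (- p) => x; rewrite hornerN -pE mulNr.
Qed.

Definition half_cos x : R := (1 - x ^+ 2) / (1 + x ^+ 2).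
Definition half_sin x : R := 2 * x / (1 + x ^+ 2).

Lemma half_angle_poly_cos : half_angle_poly half_cos.
Proof.
exists 1%N, (1 - 'X^2) => x.
by rewrite !hornerE expr1 /half_cos divfK // gt_eqF // add1sqr_gt0.
Qed.

Lemma half_angle_poly_sin : half_angle_poly half_sin.
Proof.
exists 1%N, (2%:P * 'X) => x.
by rewrite !hornerE expr1 /half_sin divfK // gt_eqF // add1sqr_gt0.
Qed.

(** The sample points start at 2: they are nonnegative and miss 1, the parameter of the north
    pole. *)
Lemma poly_eq0_nat (p : {poly R}) :
  (forall k : nat, p.[k.+2%:R] = 0) -> p = 0.
Proof.
move=> p0; apply/eqP/negPn/negP => pn0.
have /(_ [seq k.+2%:R | k <- iota 0 (size p)]) := max_poly_roots pn0.
rewrite size_map size_iota ltnn => /(_ _ _)/negP; case.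
- by apply/allP => _ /mapP[k _ ->]; rewrite /root p0.
- rewrite map_inj_uniq ?iota_uniq // => k l /eqP.
  by rewrite eqr_nat => /eqP[].
- by [].
Qed.

(** Polynomials form an integral domain, and [1 + x ^+ 2] never vanishes, so a zero numerator forces
    a zero function. *)
Lemma half_angle_poly_mul_eq0 f g : half_angle_poly f -> half_angle_poly g ->
  (forall x, 0 <= x -> x != 1 -> f x * g x = 0) ->
  (forall x, f x = 0) \/ (forall x, g x = 0).
Proof.
move=> [n [p pE]] [m [q qE]] fg0.
have X0 k x : (1 + x ^+ 2) ^+ k != 0.
  by rewrite expf_neq0 // gt_eqF ?add1sqr_gt0.
have /eqP : p * q = 0.
  apply: poly_eq0_nat => k; rewrite hornerM -pE -qE mulrACA fg0 ?mul0r //.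
  by rewrite pnatr_eq1.
rewrite mulf_eq0 => /orP[] /eqP e; [left | right] => x; apply/eqP.
  by have /eqP := pE x; rewrite e horner0 mulf_eq0 (negPf (X0 _ _)) orbF.
by have /eqP := qE x; rewrite e horner0 mulf_eq0 (negPf (X0 _ _)) orbF.
Qed.

Lemma half_cos2Dsin2 x : half_cos x ^+ 2 + half_sin x ^+ 2 = 1.
Proof.
by rewrite /half_cos /half_sin; field; rewrite gt_eqF // add1sqr_gt0.
Qed.

Lemma half_angle (c d : R) : 0 <= c -> c ^+ 2 + d ^+ 2 = 1 ->
  exists x, half_cos x = c /\ half_sin x = d.
Proof.
move=> c0 cd1; have c1 : 1 + c != 0 by rewrite gt_eqF // ltr_pwDl.
have dE : d ^+ 2 = (1 - c) * (1 + c).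
  by transitivity (1 - c ^+ 2); [rewrite -cd1; ring | ring].
have e : 1 + (d / (1 + c)) ^+ 2 = 2 / (1 + c).
  by rewrite expr_div_n dE; field.
(* The tangent of half an angle is its sine over one plus its cosine. *)
exists (d / (1 + c)); rewrite /half_cos /half_sin e; split; last by field.
by rewrite expr_div_n dE; field.
Qed.

Lemma angle_upper (c d : R) : 0 <= d -> c ^+ 2 + d ^+ 2 = 1 ->
  exists2 t, 0 <= t <= pi & cos t = c /\ sin t = d.
Proof.
move=> d0 cd1; have c1 : -1 <= c <= 1.
  by rewrite -ler_norml -(ler_pXn2r (n := 2)) ?nnegrE // expr1n
    -normrX ger0_norm ?sqr_ge0 // -cd1 lerDl sqr_ge0.
exists (acos c); first by rewrite acos_ge0 // acos_lepi.
split; first by rewrite acosK // in_itv.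
by rewrite sin_acos // -cd1 addrAC subrr add0r sqrtr_sqr ger0_norm.
Qed.

Lemma angle_full (c d : R) : c ^+ 2 + d ^+ 2 = 1 ->
  exists2 t, 0 <= t <= 2 * pi & cos t = c /\ sin t = d.
Proof.
move=> cd1; have pi0 := pi_ge0 R; have [d0|/ltW d0] := leP 0 d.
  have [t /andP[t0 t1] e] := angle_upper d0 cd1; exists t => //; apply/andP.
  by split=> //; lra.
(* A point of the lower half circle is reached from its antipode by adding [pi]. *)
have [t /andP[t0 t1] [ec es]] : exists2 t, 0 <= t <= pi &
    cos t = - c /\ sin t = - d.
  by apply: angle_upper; rewrite ?oppr_ge0 // !sqrrN.
exists (t + pi); first by apply/andP; split; lra.
by rewrite cosDpi sinDpi ec es !opprK.
Qed.

End HalfAngle.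

(** * Positivity of the lapse and vanishing of the defect on the sphere *)

Section ConstantCurvature.
Variables (R : realType) (s : R) (w b : nat -> R) (K : R).
Hypothesis hround : round_slices w.
Hypothesis hb : no_inner_translation b.
Hypothesis hproper : proper_motion s w b.
Hypothesis hK : has_constant_scalar_curvature s w b K.

Let om := omega w.
Let be := beta w b.
Let D := normb b + s ^+ 2 + rotw w - dot3 om om.

Definition vec3 (x y z : R) (i : nat) : R := [:: x; y; z]`_i.

(** The right-hand side is the squared length of the last four coordinates of [velo u]: the first
    three contribute [s ^+ 2] and the squared length of the cross product of [om] and [u]. *)
Lemma rotw_ge (u : nat -> R) : dot3 u u = 1 ->
  0 <= rotw w - dot3 om om + dot3 om u ^+ 2.
Proof.
move=> uu; have := dotv_velo s hround u u; rewrite uu mulr1 dotv7 /= => e.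
have l : (dot3 om om - dot3 om u ^+ 2) = 
  (w 1%N * u 1%N + w 2%N * u 2%N) ^+ 2 + (w 7%N * u 2%N - w 1%N * u 0%N) ^+ 2
  + (w 2%N * u 0%N + w 7%N * u 1%N) ^+ 2.
  rewrite -[dot3 om om]mulr1 -uu /om /omega /dot3 /=; ring.
have s2 : s ^+ 2 = s ^+ 2 * dot3 u u by rewrite uu mulr1.
have -> : rotw w - dot3 om om + dot3 om u ^+ 2
    = rotw w - (dot3 om om - dot3 om u ^+ 2) by ring.
rewrite l.
have -> : rotw w = (s ^+ 2 + rotw w) - s ^+ 2 by ring.
rewrite -e s2 /dot3.
set a := (w 3%N * _ + _ + _); set c := (w 4%N * _ + _ + _).
set d := (w 5%N * _ + _ + _); set f := (w 6%N * _ + _ + _).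
rewrite (_ : _ - _ = a ^+ 2 + c ^+ 2 + d ^+ 2 + f ^+ 2); last by ring.
by rewrite !addr_ge0 // sqr_ge0.
Qed.

Lemma normb_ge0 : 0 <= normb b.
Proof. by rewrite /normb !addr_ge0 // sqr_ge0. Qed.

Lemma normb_eq0 : normb b = 0 -> forall i, (1 <= i <= 7)%N -> b i = 0.
Proof.
move=> /eqP; rewrite /normb !paddr_eq0 ?addr_ge0 ?sqr_ge0 // !sqrf_eq0.
case: hb => b1 b2 b3 /andP[/andP[/andP[/eqP b4 /eqP b5] /eqP b6] /eqP b7].
by do 8! (case=> //).
Qed.

Lemma rotw_ge0 : 0 <= rotw w.
Proof. by rewrite /rotw !addr_ge0 // sqr_ge0. Qed.

(** [rotw] only involves the first six parameters; the others vanish because the columns have equal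
    length. *)
Lemma rotw_eq0 : rotw w = 0 -> forall i, (1 <= i <= 15)%N -> w i = 0.
Proof.
have [_ _ _ e4 e5] := round_slicesE hround; move=> r0.
rewrite r0 in e4 e5; move: e4 e5 r0.
rewrite /rotw => /esym/eqP + /esym/eqP + /eqP.
rewrite !paddr_eq0 ?addr_ge0 ?sqr_ge0 // !sqrf_eq0.
move=> /andP[/andP[/andP[/andP[/andP[/eqP ? /eqP ?] /eqP ?]
  /eqP ?] /eqP ?] /eqP ?].
move=> /andP[/andP[/andP[/andP[/andP[/eqP ? /eqP ?] /eqP ?]
  /eqP ?] /eqP ?] /eqP ?].
move=> /andP[/andP[/andP[/andP[/andP[/eqP ? /eqP ?] /eqP ?]
  /eqP ?] /eqP ?] /eqP ?].
by do 16! (case=> //).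
Qed.

Lemma motion_gt0 : 0 < normb b + s ^+ 2.
Proof.
have [s0|s0] := eqVneq s 0; last first.
  by rewrite ltr_wpDl ?normb_ge0 // exprn_even_gt0.
case: hproper => [/(_ s0)//|[_ [i i7 bi]]].
rewrite s0 expr0n addr0 lt_neqAle normb_ge0 andbT eq_sym.
by apply/eqP => /normb_eq0/(_ _ i7).
Qed.

(** The term linear in [u] cancels in the sum of the two values, which is positive by [motion_gt0]
    and [rotw_ge]. *)
Lemma lapse2_antipodal (u : nat -> R) : dot3 u u = 1 ->
  lapse2 s w b u = 0 -> lapse2 s w b (fun i => - u i) != 0.
Proof.
move=> uu u0; apply/eqP => v0.
have := rotw_ge uu; have := motion_gt0.
have : lapse2 s w b u + lapse2 s w b (fun i => - u i) = 0.
  by rewrite u0 v0 addr0.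
have -> : lapse2 s w b u + lapse2 s w b (fun i => - u i) =
  2 * (normb b + s ^+ 2 + (rotw w - dot3 om om + dot3 om u ^+ 2)).
  by rewrite /lapse2 -/om /dot3; ring.
by lra.
Qed.

Lemma half_angle_poly_dot3 (a : nat -> R) (c d : R) :
  half_angle_poly
    (fun x => dot3 a (vec3 (c * half_cos x) (d * half_cos x) (half_sin x))).
Proof.
rewrite /dot3 /vec3 /=.
repeat first [ exact: half_angle_poly_cst | exact: half_angle_poly_cos
  | exact: half_angle_poly_sin | apply: half_angle_polyD
  | apply: half_angle_polyM ].
Qed.

Ltac half_angle_tac :=
  repeat first [ exact: half_angle_poly_cst | exact: half_angle_poly_cos
  | exact: half_angle_poly_sin | exact: half_angle_poly_dot3
  | apply: half_angle_polyD | apply: half_angle_polyN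
  | apply: half_angle_polyM ].

Lemma half_angle_poly_lapse2 (c d : R) : half_angle_poly (fun x =>
  lapse2 s w b (vec3 (c * half_cos x) (d * half_cos x) (half_sin x))).
Proof. by rewrite /lapse2; half_angle_tac. Qed.

Definition defect (u : nat -> R) : R :=
  curvature_form s w b u - 2 * K * lapse2 s w b u ^+ 2.

Lemma half_angle_poly_defect (c d : R) : half_angle_poly (fun x =>
  defect (vec3 (c * half_cos x) (d * half_cos x) (half_sin x))).
Proof.
rewrite /defect /curvature_form /det3 /vec3 /=.
half_angle_tac; exact: half_angle_poly_lapse2.
Qed.

(** [0 <= x] places the point in the upper hemisphere, reached by some [phi] in [[0, pi]], and
    [x != 1] keeps it off the pole. The factor [lapse2] absorbs the points where it vanishes
    itself. *)
Lemma defect_hemisphere (c d x : R) : c ^+ 2 + d ^+ 2 = 1 -> 0 <= x -> x != 1 ->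
  let u := vec3 (c * half_cos x) (d * half_cos x) (half_sin x) in
  defect u * lapse2 s w b u = 0.
Proof.
move=> cd x0 x1 u; have [->|V0] := eqVneq (lapse2 s w b u) 0.
  by rewrite mulr0.
have [th th2pi [thc thd]] := angle_full cd.
have xs0 : 0 <= half_sin x.
  by rewrite /half_sin divr_ge0 ?mulr_ge0 // ltW // add1sqr_gt0.
have [ph phpi [phc phs]] := angle_upper xs0 (half_cos2Dsin2 x).
have uE : u = sph th ph by rewrite /u /sph thc thd phc phs.
have C0 : cos ph != 0.
  rewrite phc /half_cos mulf_neq0 //; last first.
    by rewrite invr_eq0 gt_eqF // add1sqr_gt0.
  by rewrite subr_eq0 eq_sym sqrf_eq1 negb_or x1 /= gt_eqF //; lra.
rewrite uE in V0 *.
have [gu e] := kinematic_curvature hround hb C0 V0.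
by rewrite /defect -e (hK th2pi phpi gu); ring.
Qed.

(** On the meridian circle through [u], either the defect or [lapse2] vanishes identically; the
    latter fails at the two poles. *)
Lemma defect_eq0 (u : nat -> R) : dot3 u u = 1 -> defect u = 0.
Proof.
move=> uu; pose r := Num.sqrt (u 0%N ^+ 2 + u 1%N ^+ 2).
have r2 : r ^+ 2 = u 0%N ^+ 2 + u 1%N ^+ 2.
  by rewrite sqr_sqrtr // addr_ge0 // sqr_ge0.
have [c [d [cd uc ud]]] : exists c d,
    [/\ c ^+ 2 + d ^+ 2 = 1, u 0%N = c * r & u 1%N = d * r].
  have [r0|r0] := eqVneq r 0.
    (* A pole lies on every meridian, so any direction will do. *)
    exists 1, 0; rewrite r0 expr0n addr0 expr1n !mulr0; split=> //.
      by move/eqP: r2; rewrite r0 expr0n eq_sym paddr_eq0 ?sqr_ge0 // !sqrf_eq0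
        => /andP[/eqP].
    by move/eqP: r2; rewrite r0 expr0n eq_sym paddr_eq0 ?sqr_ge0 // !sqrf_eq0
      => /andP[_ /eqP].
  exists (u 0%N / r), (u 1%N / r); rewrite !divfK //; split=> //.
  by rewrite !expr_div_n -mulrDl -r2 divff // expf_neq0.
have ru : r ^+ 2 + u 2%N ^+ 2 = 1 by rewrite r2 -uu /dot3; ring.
have [x [xc xs]] := half_angle (sqrtr_ge0 _) ru.
have -> : defect u =
    defect (vec3 (c * half_cos x) (d * half_cos x) (half_sin x)).
  by rewrite xc xs -uc -ud.
have [//|V0] := half_angle_poly_mul_eq0 (half_angle_poly_defect c d)
  (half_angle_poly_lapse2 c d) (fun x => @defect_hemisphere c d x cd).
(* The parameters 1 and -1 give the north and south poles, where [lapse2] cannot vanish together. *)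
have north : dot3 (vec3 0 0 1) (vec3 0 0 1) = 1 by rewrite /dot3 /vec3 /=; ring.
have V1 := V0 1; have V2 := V0 (-1).
have c1 : half_cos (1 : R) = 0 by rewrite /half_cos expr1n subrr mul0r.
have c2 : half_cos (- 1 : R) = 0 by rewrite /half_cos sqrrN expr1n subrr mul0r.
have s1 : half_sin (1 : R) = 1 by rewrite /half_sin; field.
have s2 : half_sin (- 1 : R) = - 1 by rewrite /half_sin; field.
rewrite c1 s1 !mulr0 in V1; rewrite c2 s2 !mulr0 in V2.
have := lapse2_antipodal north V1.
rewrite (_ : lapse2 _ _ _ _ = lapse2 s w b (vec3 0 0 (-1))) ?V2 ?eqxx //.
by rewrite /lapse2 /dot3 /vec3 /= oppr0.
Qed.

(** * Comparison of coefficients *)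

Lemma unit_orthogonal (x : nat -> R) :
  exists q : nat -> R, dot3 q q = 1 /\ dot3 x q = 0.
Proof.
pose r2 := x 0%N ^+ 2 + x 1%N ^+ 2; pose r := Num.sqrt r2.
have r2_ge0 : 0 <= r2 by rewrite addr_ge0 // sqr_ge0.
have rE : r ^+ 2 = r2 by rewrite sqr_sqrtr.
have [r0|r0] := eqVneq r 0.
  exists (vec3 1 0 0); rewrite /dot3 /vec3 /=; split; first by ring.
  move/eqP: rE; rewrite r0 expr0n eq_sym paddr_eq0 ?sqr_ge0 // !sqrf_eq0.
  by move=> /andP[/eqP-> _]; ring.
exists (vec3 (- x 1%N / r) (x 0%N / r) 0); rewrite /dot3 /vec3 /=.
split; last by field.
transitivity (r2 / r ^+ 2); first by rewrite /r2; field.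
by rewrite rE divff // -rE expf_neq0.
Qed.

Lemma dot3_gt0 (x : nat -> R) : dot3 x x != 0 -> 0 < dot3 x x.
Proof.
by move=> x0; rewrite lt_neqAle eq_sym x0 /dot3 -!expr2 !addr_ge0 // sqr_ge0.
Qed.

Lemma dot3_eq0 (x : nat -> R) : dot3 x x = 0 ->
  [/\ x 0%N = 0, x 1%N = 0 & x 2%N = 0].
Proof.
rewrite /dot3 -!expr2 => /eqP; rewrite !paddr_eq0 ?addr_ge0 ?sqr_ge0 //.
by rewrite !sqrf_eq0 => /andP[/andP[/eqP ? /eqP ?] /eqP ?].
Qed.

Definition normalize (x : nat -> R) (i : nat) : R := x i / Num.sqrt (dot3 x x).

Lemma dot3_normalize x : dot3 x x != 0 ->
  dot3 (normalize x) (normalize x) = 1.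
Proof.
move=> x0; have n2 := sqr_sqrtr (ltW (dot3_gt0 x0)).
have n0 : Num.sqrt (dot3 x x) != 0 by rewrite sqrtr_eq0 -ltNge dot3_gt0.
rewrite -[RHS](divff x0) -{2}n2.
move: n0; rewrite /normalize; set n := Num.sqrt _ => n0.
by rewrite /dot3; field.
Qed.

(** Otherwise the defect is restricted to the great circle spanned by the axis direction [p] and an
    orthogonal [q]. Only the components [a] and [c] of [be] in that plane need to be killed. *)
Lemma rotation_eq0 : dot3 om om = 0.
Proof.
apply/eqP/negPn/negP => W0.
have [q [qq oq]] := unit_orthogonal om.
have pp := dot3_normalize W0; set p := normalize om in pp.
have W_gt0 := dot3_gt0 W0.
have n2 := sqr_sqrtr (ltW W_gt0).
set n := Num.sqrt (dot3 om om) in n2.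
have n0 : n != 0 by rewrite sqrtr_eq0 -ltNge.
have omE i : om i = n * p i by rewrite /p /normalize mulrC divfK.
have pq : dot3 p q = 0.
  by apply: (mulfI n0); rewrite mulr0 -oq /dot3 !omE; ring.
pose a := dot3 be p; pose c := dot3 be q; pose k := det3 om q be.
pose W := dot3 om om; pose B := dot3 be be; pose m := s ^+ 2 + 2 * rotw w.
pose V x y := D + 2 * (x * a + y * c) + W * x ^+ 2.
(* [phi x y] is the defect at [x p + y q].  Combinations of its values at
   rational points of the circle, even or odd in [x] and [y], isolate the
   coefficients of degree 4, 3 and 2. *)
pose phi x y := 4 * V x y ^+ 2
  - 2 * V x y * (2 * W - 4 * (x * a + y * c) - 6 * (W * x ^+ 2))
  + 4 * (B - (x * a + y * c) ^+ 2) + 8 * W * x * (a - x * (x * a + y * c))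
  + 4 * W * x ^+ 2 * (W - W * x ^+ 2)
  - 4 * V x y * (m + 2 * (x * a + y * c))
  + 8 * s * (s * (W - W * x ^+ 2) - 2 * y * k) - 2 * K * V x y ^+ 2.
have phi0 x y : x ^+ 2 + y ^+ 2 = 1 -> phi x y = 0.
  move=> xy; pose u i := x * p i + y * q i.
  have uu : dot3 u u = 1.
    transitivity (x ^+ 2 * dot3 p p + 2 * x * y * dot3 p q + y ^+ 2 * dot3 q q).
      by rewrite /dot3 /u; ring.
    by rewrite pp qq pq mulr0 addr0 !mulr1.
  have bu : dot3 be u = x * a + y * c by rewrite /a /c /dot3 /u; ring.
  have op : dot3 om p = n.
    by rewrite -[RHS]mulr1 -pp /dot3 !omE; ring.
  have ou : dot3 om u = n * x.
    transitivity (x * dot3 om p + y * dot3 om q).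
      by rewrite /dot3 /u; ring.
    by rewrite op oq; ring.
  have ob : dot3 om be = n * a by rewrite /a /dot3 !omE; ring.
  have du : det3 om u be = y * k.
    by rewrite /k /det3 /u !omE; ring.
  have := defect_eq0 uu; rewrite /defect /curvature_form /lapse2 -/om -/be.
  rewrite bu ou ob du -/D -/B -/W => <-.
  by rewrite /phi /V /m (_ : W = n ^+ 2) //; ring.
have e10 : phi 1 0 = 0 by apply: phi0; ring.
have eN0 : phi (-1) 0 = 0 by apply: phi0; ring.
have e01 : phi 0 1 = 0 by apply: phi0; ring.
have e0N : phi 0 (-1) = 0 by apply: phi0; ring.
have epp : phi (3/5) (4/5) = 0 by apply: phi0; field.
have epn : phi (3/5) (-(4/5)) = 0 by apply: phi0; field.
have enp : phi (-(3/5)) (4/5) = 0 by apply: phi0; field.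
have enn : phi (-(3/5)) (-(4/5)) = 0 by apply: phi0; field.
have W0' : W != 0 by [].
have K6 : K = 6.
  have : W ^+ 2 * (12 - 2 * K) = 0.
    (* Weighting the mean axis values by 9/25 and 16/25 cancels degrees 0 and 2. What remains is
       [x ^+ 4], with coefficient [W ^+ 2 * (12 - 2 * K)] and factor 81/625 - 9/25 = -144/625. *)
    transitivity (- (625 / 144) * ((phi (3/5) (4/5) + phi (3/5) (-(4/5))
      + phi (-(3/5)) (4/5) + phi (-(3/5)) (-(4/5))) / 4
      - 9 / 50 * (phi 1 0 + phi (-1) 0) - 16 / 50 * (phi 0 1 + phi 0 (-1)))).
      by rewrite /phi /V; field.
    by rewrite e10 eN0 e01 e0N epp epn enp enn; ring.
  move=> /eqP; rewrite mulf_eq0 expf_eq0 (negPf W0') /= => /eqP; lra.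
have a0 : a = 0.
  apply: (mulfI W0'); rewrite mulr0.
  (* The part odd in [x] and even in [y] is linear plus [- 16 * a * W * x ^+ 3]; removing the linear
     term leaves the factor 27/125 - 3/5 = -48/125. The next step treats [- 16 * c * W * x ^+ 2 * y]
     likewise, with factor 36/125. *)
  transitivity (125 / 768 * ((phi (3/5) (4/5) + phi (3/5) (-(4/5))
      - phi (-(3/5)) (4/5) - phi (-(3/5)) (-(4/5))) / 4
      - 3 / 10 * (phi 1 0 - phi (-1) 0))).
    by rewrite /phi /V K6; field.
  by rewrite e10 eN0 epp epn enp enn; ring.
have c0 : c = 0.
  apply: (mulfI W0'); rewrite mulr0.
  transitivity (- (125 / 576) * ((phi (3/5) (4/5) - phi (3/5) (-(4/5))
      + phi (-(3/5)) (4/5) - phi (-(3/5)) (-(4/5))) / 4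
      - 2 / 5 * (phi 0 1 - phi 0 (-1)))).
    by rewrite /phi /V K6; field.
  by rewrite e01 e0N epp epn enp enn; ring.
have Dm : D + 2 * s ^+ 2 + m = 0.
  apply: (mulfI W0'); rewrite mulr0.
  transitivity (- (phi 1 0 + phi (-1) 0 - phi 0 1 - phi 0 (-1)) / 8).
    by rewrite /phi /V K6 a0 c0; field.
  by rewrite e10 eN0 e01 e0N; ring.
(* Since [q] is orthogonal to [om], this reads [W <= rotw w]. Hence [D] is nonnegative and [m]
   positive, against [Dm]. *)
have := rotw_ge qq; rewrite oq expr0n addr0 => rW.
have := normb_ge0; have := sqr_ge0 s; move: Dm; rewrite /D /m.
by move: W_gt0 rW; lra.
Qed.

(** * Motions without inner rotation and the final bound *)

Lemma defect_no_rotation (u : nat -> R) : dot3 u u = 1 ->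
  let V := normb b + s ^+ 2 + rotw w + 2 * dot3 be u in
  4 * V ^+ 2 + 8 * V * dot3 be u + 4 * (dot3 be be - dot3 be u ^+ 2)
  - 4 * V * (s ^+ 2 + 2 * rotw w + 2 * dot3 be u) - 2 * K * V ^+ 2 = 0.
Proof.
move=> uu V; have [z0 z1 z2] := dot3_eq0 rotation_eq0.
have o x : dot3 om x = 0 by rewrite /dot3 z0 z1 z2; ring.
have d : det3 om u be = 0 by rewrite /det3 z0 z1 z2; ring.
rewrite -(defect_eq0 uu) /defect /curvature_form /lapse2 -/om -/be !o d /V.
ring.
Qed.

Lemma constant_curvature_lt2 : `|K| < 2.
Proof.
have [B0|B0] := eqVneq (dot3 be be) 0; last first.
  have pp := dot3_normalize B0; set p := normalize be in pp.
  have [q [qq bq]] := unit_orthogonal be.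
  have n2 := sqr_sqrtr (ltW (dot3_gt0 B0)).
  set n := Num.sqrt (dot3 be be) in n2.
  have n0 : n != 0 by rewrite sqrtr_eq0 -ltNge dot3_gt0.
  have bp : dot3 be p = n.
    apply: (mulfI n0); rewrite -expr2 n2 /p /normalize -/n /dot3; field.
    exact: n0.
  have np : dot3 (fun i => - p i) (fun i => - p i) = 1.
    by rewrite -pp /dot3; ring.
  have bn : dot3 be (fun i => - p i) = - n by rewrite -bp /dot3; ring.
  have := defect_no_rotation pp; have := defect_no_rotation np.
  have := defect_no_rotation qq; rewrite /= bq bp bn -n2.
  set Q := normb b + s ^+ 2 + rotw w => e0 e1 e2.
  (* The equation is quadratic in [dot3 be u], which takes the values [n], [- n] and 0; the second
     difference isolates the leading coefficient. *)
  have : n ^+ 2 * (12 - 8 * K) = 0 by lra.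
  move=> /eqP; rewrite mulf_eq0 expf_eq0 (negPf n0) /= => /eqP K32.
  by rewrite (_ : K = 3 / 2) ?ger0_norm; lra.
have [b0 b1 b2] := dot3_eq0 B0.
have [q [qq bq]] := unit_orthogonal be.
have := defect_no_rotation qq; rewrite /= bq B0.
set Q := normb b + s ^+ 2 + rotw w => e.
have nb0 := normb_ge0; have r0 := rotw_ge0; have ns0 := motion_gt0.
have s20 := sqr_ge0 s.
have Q0 : 0 < Q by rewrite /Q; lra.
(* The equation at [q] divided by [2 * Q]. *)
have KQ : Q * K = 2 * Q - 2 * (s ^+ 2 + 2 * rotw w).
  by apply: (mulfI (lt0r_neq0 Q0)); lra.
have sr : 0 < s ^+ 2 + 2 * rotw w.
  have [s0|s0] := eqVneq s 0; last first.
    by rewrite ltr_pwDl ?mulr_ge0 // exprn_even_gt0.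
  case: hproper => [/(_ s0)//|[[i i15 wi] _]].
  rewrite s0 expr0n add0r mulr_gt0 // lt_neqAle r0 andbT eq_sym.
  by apply/eqP => /rotw_eq0/(_ _ i15).
(* After multiplication by [Q], the upper bound is [sr] and the lower one amounts to
   [0 < 2 * normb b + s ^+ 2], which follows from [motion_gt0]. *)
rewrite ltr_norml -(ltr_pM2l Q0) -[K < 2](ltr_pM2l Q0) KQ.
by apply/andP; split; rewrite /Q; lra.
Qed.

End ConstantCurvature.

Theorem corollary3p5 (R : realType) (s : R) (w b : nat -> R) (K : R)
  (hround : round_slices w)
  (hb : no_inner_translation b)
  (hproper : proper_motion s w b)
  (hK : has_constant_scalar_curvature s w b K) :
  `|K| < 2.
Proof. exact: constant_curvature_lt2 hround hb hproper hK. Qed.
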